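(* Let $\beta$ and $d$ be positive integers with $d\ge \beta+2$. Then there exists a $d$-dimensional integral polytope $\mathcal{P}$ such that the coefficients of $t^{d-2},t^{d-3},\dots,t^{d-\beta-1}$ in $i(\mathcal{P},t)$ are positive, and the coefficients of $t^{d-\beta-2},t^{d-\beta-3},\dots,t^{1}$ in $i(\mathcal{P},t)$ are negative.
   Context: An integral polytope is a convex polytope all of whose vertices have integer coordinates. For an integral polytope $\mathcal{P}\subseteq\mathbb{R}^N$ of dimension $d$, $i(\mathcal{P},t)=|t\mathcal{P}\cap\mathbb{Z}^N|$ ($t$ a positive integer), where $t\mathcal{P}=\{t\alpha:\alpha\in\mathcal{P}\}$, is a polynomial in $t$ of degree $d$, called the Ehrhart polynomial of $\mathcal{P}$. *)

(* Defs.v *)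
From mathcomp Require Export all_boot all_order all_algebra.
From mathcomp Require Export boolp classical_sets cardinality reals convex.

Set Implicit Arguments.
Unset Strict Implicit.
Unset Printing Implicit Defensive.

Import Order.TTheory GRing.Theory Num.Theory.
Local Open Scope classical_set_scope.
Local Open Scope card_scope.
Local Open Scope ring_scope.

Section Polytopes.
Context {R : realType} {N : nat}.
Implicit Types (A P : set 'rV[R]_N) (v x : 'rV[R]_N).

Definition convex_hull A : set 'rV[R]_N :=
  smallest (@convex_set R 'rV[R]_N) A.

Definition convex_polytope P : Prop :=
  exists2 A, finite_set A & P = convex_hull A.

(* The singleton [set v] is a face of P, cut out by the supporting hyperplane
   x *m c = b (the 1 x 1 matrix x *m c is the scalar product of x and c). *)
Definition vertex P v : Prop :=
  exists (c : 'cV[R]_N) (b : R),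
    (forall x, P x -> (x *m c) 0 0 <= b) /\
    P `&` [set x | (x *m c) 0 0 = b] = [set v].

Definition integral_polytope P : Prop :=
  convex_polytope P /\ forall v, vertex P v -> v \is a mxOver Num.int.

Definition affine_set A : Prop :=
  forall x y (a : R), A x -> A y -> A ((1 - a) *: x + a *: y).

Definition affine_hull A : set 'rV[R]_N := smallest affine_set A.

(* The affine hull of P is a translate of a d-dimensional linear subspace; no
   d satisfies this when P is empty. *)
Definition has_dim P (d : nat) : Prop :=
  exists x0 (U : {vspace 'rV[R]_N}),
    affine_hull P = [set x0 + u | u in [set u | u \in U]] /\ \dim U = d.

Definition dilate (t : nat) P : set 'rV[R]_N := [set t%:R *: x | x in P].

Definition lattice_points P : set 'rV[R]_N :=
  P `&` [set x | x \is a mxOver Num.int].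

(* At most one p satisfies this, since p is prescribed at infinitely many
   points. *)
Definition ehrhart_polynomial P (p : {poly R}) : Prop :=
  forall t : nat, (0 < t)%N ->
    exists2 n : nat, lattice_points (dilate t P) #= `I_n & p.[t%:R] = n%:R.

End Polytopes.

(* Main.v *)
(* Cutting the unit square along both diagonals gives the polytope
     m max(0, x + y - 1) <= z <= m min(x, y) + s x,   0 <= x, y <= 1,
   a thickened Reeve tetrahedron.  Its t-th dilation has
   m (min(x, y) - max(0, x + y - t)) + s x + 1 lattice points above (x, y), and
   summing the bracket over y leaves x (t - x), so that
     i(t) = (t + 1)^2 + m (t^3 - t) / 6 + s t (t + 1)^2 / 2.
   For m = 6E + 3cE and s = cE this is (t + 1)^2 + E ((c + 1) t^3 + c t^2 - t),
   affine in E, and for E large only the signs of the factor of E matter.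
   With c = beta + 1, the product with the cube [0,1]^beta makes that factor
   negative at t and positive at t^2, ..., t^(beta+3).  The product with a long
   segment [0,n] multiplies it by n t + 1, which for n large enough turns the
   first positive coefficient negative and keeps all other signs.  This is
   done d - beta - 3 times, and E is chosen at the end. *)
Require Import Defs.
From mathcomp Require Import all_boot all_order all_algebra.
From mathcomp Require Import boolp classical_sets cardinality.
From mathcomp Require Import interval_inference reals convex.
From mathcomp Require Import zify ring lra.

Set Implicit Arguments.
Unset Strict Implicit.
Unset Printing Implicit Defensive.

Import Order.TTheory GRing.Theory Num.Theory.
Local Open Scope classical_set_scope.
Local Open Scope ring_scope.

(** * Cardinality by explicit enumeration *)

Lemma card_eq_inj_image (T : finType) (U : Type) (f : T -> U) (A : set U) :
  injective f -> (forall u, A u <-> exists t, f t = u) -> (A #= `I_#|T|)%card.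
Proof.
move=> f_inj AE; have ->: A = f @` setT.
  apply/seteqP; split=> u; first by move=> /AE[t <-]; exists t.
  by case=> t _ <-; apply/AE; exists t.
have ->: `I_#|T| = (fun t : T => enum_rank t : nat) @` setT.
  apply/seteqP; split=> i /=; last by case=> t _ <-; exact: ltn_ord.
  by move=> ltiT; exists (enum_val (Ordinal ltiT)); rewrite ?enum_valK.
apply: card_eq_trans (inj_card_eq (in2W f_inj)) _.
rewrite card_eq_sym; apply: inj_card_eq; apply: in2W => s t /val_inj.
exact: enum_rank_inj.
Qed.

Lemma card_eqI_enum (U : Type) (A : set U) n : (A #= `I_n)%card ->
  exists2 f : 'I_n -> U, injective f & forall u, A u <-> exists i, f i = u.
Proof.
case/card_set_bijP=> g [gI g_inj g_surj].
have h (i : 'I_n) : {u : U | A u /\ g u = i}.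
  by apply: cid; have [u Au gu] := g_surj i (ltn_ord i); exists u.
exists (fun i => sval (h i)) => [i j|u].
  case: (h i) (h j) => [x [Ax gx]] [y [Ay gy]] /= xy.
  by apply: val_inj; rewrite /= -gx -gy xy.
split=> [Au|[i <-]]; last by case: (h i) => x [].
exists (Ordinal (gI _ Au)); case: (h _) => x [Ax gx] /=.
by apply: g_inj; rewrite ?inE.
Qed.

(** * Convex and affine hulls, and their behaviour under products *)

Section CombinationHulls.
Context {R : realType}.

(** Convex sets are the case [D = unit_interval] and affine sets the case [D = setT], so that the
    product formula for both hulls is proved only once. *)
Definition comb_closed N (D : set R) (C : set 'rV[R]_N) : Prop :=
  forall x y a, D a -> C x -> C y -> C (a *: x + (1 - a) *: y).

Definition unit_interval : set R := [set a | 0 <= a <= 1].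

Lemma convex_setE N (C : set 'rV[R]_N) :
  convex_set C = comb_closed unit_interval C.
Proof.
apply/propext; split=> [cvxC x y a a01 Cx Cy|cC x y k].
  have := cvxC x y (Itv01 (andP a01).1 (andP a01).2).
  by rewrite !inE; apply.
rewrite !inE => Cx Cy; apply: cC => //=.
by rewrite /unit_interval /= ge0 le1.
Qed.

Lemma affine_setE N (C : set 'rV[R]_N) : affine_set C = comb_closed setT C.
Proof.
apply/propext; split=> affC x y a => [_|] Cx Cy.
  by have := affC x y (1 - a) Cx Cy; rewrite subKr.
by have := affC x y (1 - a) I Cx Cy; rewrite subKr.
Qed.

Lemma convex_hullE N (A : set 'rV[R]_N) :
  convex_hull A = smallest (comb_closed unit_interval) A.
Proof.
by rewrite /convex_hull; congr smallest; apply/funext => C; rewrite convex_setE.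
Qed.

Lemma affine_hullE N (A : set 'rV[R]_N) :
  affine_hull A = smallest (comb_closed setT) A.
Proof.
by rewrite /affine_hull; congr smallest; apply/funext => C; rewrite affine_setE.
Qed.

Definition prod_set N M (A : set 'rV[R]_N) (B : set 'rV[R]_M) :
  set 'rV[R]_(N + M) := [set v | A (lsubmx v) /\ B (rsubmx v)].

Lemma comb_closed_prod N M D (A : set 'rV[R]_N) (B : set 'rV[R]_M) :
  comb_closed D A -> comb_closed D B -> comb_closed D (prod_set A B).
Proof.
move=> cA cB x y a Da [Ax Bx] [Ay By].
by split; rewrite linearD !linearZ; [apply: cA | apply: cB].
Qed.

Lemma comb_closed_smallest N D (A : set 'rV[R]_N) :
  comb_closed D (smallest (comb_closed D) A).
Proof.
by move=> x y a Da hx hy C hC; apply: hC.1 => //; [apply: hx|apply: hy].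
Qed.

(** For the inclusion from right to left, one coordinate is freed at a time. Let [C] be closed and
    contain the product. For fixed [x] in [A], the [y] with [row_mx x y] in [C] form a closed set
    containing [B], hence its hull; then for fixed [y] in the hull of [B] the same argument applies
    to [x]. *)
Lemma smallest_prod N M D (A : set 'rV[R]_N) (B : set 'rV[R]_M) :
  smallest (comb_closed D) (prod_set A B) =
  prod_set (smallest (comb_closed D) A) (smallest (comb_closed D) B).
Proof.
apply/seteqP; split=> v.
  apply: smallest_sub.
    by apply: comb_closed_prod; apply: comb_closed_smallest.
  by move=> x [Ax Bx]; split; apply: sub_gen_smallest.
case=> hA hB C [cC ABC]; rewrite -[v]hsubmxK.
have fiber x : A x -> smallest (comb_closed D) B `<=` [set y | C (row_mx x y)].
  move=> Ax; apply: smallest_sub => [y z a Da Cy Cz|y By] /=; last first.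
    by apply: ABC; split; rewrite ?row_mxKl ?row_mxKr.
  have := cC _ _ a Da Cy Cz.
  by rewrite !scale_row_mx add_row_mx -scalerDl subrKC scale1r.
set y := rsubmx v in hB *.
apply: (@smallest_sub _ (comb_closed D) A [set x | C (row_mx x y)] _ _ _ hA).
  move=> x z a Da Cx Cz /=.
  have := cC _ _ a Da Cx Cz.
  by rewrite !scale_row_mx add_row_mx -scalerDl subrKC scale1r.
by move=> x Ax /=; exact: fiber Ax _ hB.
Qed.

(** If [v] were not in [A], then all of [A] would lie in the open half-space below the supporting
    hyperplane at [v]. This half-space is convex, so it would contain the hull and thus [v], which
    lies on the hyperplane. *)
Lemma convex_hull_vertex N (A : set 'rV[R]_N) v :
  vertex (convex_hull A) v -> A v.
Proof.
case=> c [b [le_b maxE]]; apply: contrapT => nAv.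
have [hv /= cvb] : (convex_hull A `&` [set x | (x *m c) 0 0 = b]) v.
  by rewrite maxE.
have sub x : A x -> convex_hull A x by apply: sub_gen_smallest.
suff : [set x | (x *m c) 0 0 < b] v by rewrite /= cvb ltxx.
move: hv; rewrite convex_hullE; apply: smallest_sub => [x y a a01 /= cx cy|x Ax].
  rewrite mulmxDl -!scalemxAl mxE [X in X + _]mxE [X in _ + X]mxE; case/andP: a01 => + a1.
  by rewrite le_eqVlt => /predU1P[<-|a0]; nra.
rewrite /= lt_neqAle le_b ?andbT; last exact: sub.
apply/eqP => cxb; apply: nAv.
by have: [set v] x by [rewrite -maxE; split => //; exact: sub|]; move=> /= <-.
Qed.

End CombinationHulls.

Lemma card_eq_prod (R : realType) N M (A : set 'rV[R]_N) (B : set 'rV[R]_M) n m :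
  (A #= `I_n)%card -> (B #= `I_m)%card -> (prod_set A B #= `I_(n * m))%card.
Proof.
move=> /card_eqI_enum[f f_inj fE] /card_eqI_enum[g g_inj gE].
rewrite -[n in (n * m)%N]card_ord -[m in (_ * m)%N]card_ord -card_prod.
apply: (@card_eq_inj_image _ _ (fun ij => row_mx (f ij.1) (g ij.2))).
  by move=> [i j] [i' j'] /= /eq_row_mx[/f_inj -> /g_inj ->].
move=> v; split=> [[/fE[i fi] /gE[j gj]]|[[i j] <-]].
  by exists (i, j); rewrite /= fi gj hsubmxK.
by split; rewrite ?row_mxKl ?row_mxKr; [apply/fE; exists i | apply/gE; exists j].
Qed.

(** * Ehrhart polynomials of full-dimensional polytopes, their products, and segments *)

Section Realization.
Context {R : realType}.

(** The conditions bear on a generating set rather than on the polytope, since they then pass to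
    products at once. Integral generators give integral vertices by [convex_hull_vertex]. *)
Definition realizable N (p : {poly R}) : Prop :=
  exists A : set 'rV[R]_N,
    [/\ finite_set A, forall v, A v -> v \is a mxOver Num.int,
        affine_hull A = setT & ehrhart_polynomial (convex_hull A) p].

Lemma realizable_polytope N p : realizable N p ->
  exists P : set 'rV[R]_N,
    [/\ integral_polytope P, has_dim P N & ehrhart_polynomial P p].
Proof.
case=> A [finA intA affA ehrA]; exists (convex_hull A); split=> //.
  by split; [exists A | move=> v /convex_hull_vertex /intA].
exists 0, fullv; split; last by rewrite dimvf /dim /= mul1n.
apply/seteqP; split=> v _; first by exists v; rewrite ?add0r //= memvf.
have : affine_hull A v by rewrite affA.
rewrite !affine_hullE; apply: smallest_sub.
  exact: comb_closed_smallest.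
by move=> x Ax; do 2 apply: sub_gen_smallest.
Qed.

Lemma lattice_points_prod N M t (P : set 'rV[R]_N) (Q : set 'rV[R]_M) :
  lattice_points (dilate t (prod_set P Q)) =
  prod_set (lattice_points (dilate t P)) (lattice_points (dilate t Q)).
Proof.
apply/seteqP; split=> v.
  case=> -[x [Px Qx] <-] /mxOverP xint; split; split.
  - by exists (lsubmx x); rewrite // linearZ.
  - by apply/mxOverP => i j; rewrite mxE xint.
  - by exists (rsubmx x); rewrite // linearZ.
  - by apply/mxOverP => i j; rewrite mxE xint.
case=> -[[x Px xv] /mxOverP lint] [[y Qy yv] /mxOverP rint]; split.
  exists (row_mx x y); first by split; rewrite ?row_mxKl ?row_mxKr.
  by rewrite scale_row_mx xv yv hsubmxK.
apply/mxOverP => i j; rewrite -[v]hsubmxK mxE.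
by case: splitP => k _; [exact: lint | exact: rint].
Qed.

(** Hulls, dilations and lattice points all commute with products, so the counts multiply. *)
Lemma realizableM N M p q :
  realizable N p -> realizable M q -> realizable (N + M) (p * q).
Proof.
move=> [A [/finite_setP[n An] intA affA ehrA]].
move=> [B [/finite_setP[m Bm] intB affB ehrB]].
exists (prod_set A B); split.
- by apply/finite_setP; exists (n * m)%N; exact: card_eq_prod.
- move=> v [/intA/mxOverP lint /intB/mxOverP rint].
  by apply/mxOverP => i j; rewrite -[v]hsubmxK mxE; case: splitP => k _.
- rewrite affine_hullE smallest_prod -!affine_hullE affA affB.
  exact/seteqP.
- move=> t t_gt0; have [k Ak pk] := ehrA t t_gt0; have [l Bl ql] := ehrB t t_gt0.
  exists (k * l)%N; last by rewrite hornerM pk ql natrM.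
  rewrite convex_hullE smallest_prod -!convex_hullE lattice_points_prod.
  exact: card_eq_prod.
Qed.

Lemma natr_of_int_ge0 (x : R) : x \is a Num.int -> 0 <= x -> exists k : nat, x = k%:R.
Proof. by move=> xint x_ge0; apply/natrP; rewrite natrEint xint. Qed.

Lemma realizable_segment n : (0 < n)%N -> realizable 1 (n%:R *: 'X + 1).
Proof.
move=> n_gt0; have nR_gt0 : 0 < n%:R :> R by rewrite ltr0n.
set A : set 'rV[R]_1 := [set 0; const_mx n%:R].
(* This combination of the endpoints serves both hulls: its weight lies in [0,1] exactly on the
   segment, and the affine hull allows any weight. *)
have vE (v : 'rV[R]_1) : v = (v 0 0 / n%:R) *: const_mx n%:R + (1 - v 0 0 / n%:R) *: 0.
  by apply/rowP => i; rewrite !mxE !ord1 mulr0 addr0 divfK // gt_eqF.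
have hullE : convex_hull A = [set v | 0 <= v 0 0 <= n%:R].
  rewrite convex_hullE; apply/seteqP; split; last first.
  - move=> v /= /andP[v0 vn] C [cC AC]; rewrite [v]vE; apply: cC.
    + by rewrite /unit_interval /= divr_ge0 ?ler_pdivrMr ?mul1r // ltW.
    + by apply: AC; right.
    + by apply: AC; left.
  - apply: smallest_sub => [x y a /= /andP[a0 a1] /andP[x0 xn] /andP[y0 yn]|x].
      by rewrite !mxE; apply/andP; split; nra.
    by case=> -> /=; rewrite !mxE ?lexx ?ltW.
exists A; split.
- by rewrite finite_setU; split; exact: finite_set1.
- move=> v; case=> ->; apply/mxOverP => i j; rewrite !mxE ?rpred0 ?rpred_nat //.
- rewrite affine_hullE; apply/seteqP; split=> v // _ C [cC AC].
  by rewrite [v]vE; apply: cC => //; apply: AC; [right|left].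
move=> t t_gt0; exists (n * t).+1; last first.
  by rewrite !hornerE -natr1 natrM.
have tR_gt0 : 0 < t%:R :> R by rewrite ltr0n.
rewrite -[X in `I_X]card_ord.
apply: (@card_eq_inj_image _ _ (fun i : 'I_(n * t).+1 => const_mx i%:R)).
  move=> i j /rowP/(_ 0); rewrite !mxE => /eqP; rewrite eqr_nat => /eqP.
  exact: val_inj.
rewrite hullE => v; split=> [[[x /= /andP[x0 xn] xv] /mxOverP vint]|[i <-]].
  have v0 : v 0 0 = t%:R * x 0 0 by rewrite -xv mxE.
  have [|k kE] := natr_of_int_ge0 (vint 0 0).
    by rewrite v0 mulr_ge0 // ltW.
  have ltk : (k < (n * t).+1)%N.
    by rewrite ltnS -(ler_nat R) natrM -kE v0 mulrC ler_pM2r.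
  by exists (Ordinal ltk); apply/rowP => i; rewrite mxE /= -kE !ord1.
split; last by apply/mxOverP => k l; rewrite mxE rpred_nat.
exists (const_mx (i%:R / t%:R)).
  by rewrite /= mxE divr_ge0 ?ler0n //= ler_pdivrMr // -natrM ler_nat -ltnS.
by apply/rowP => k; rewrite !mxE mulrC divfK // gt_eqF.
Qed.

Lemma realizableXn N p e n : (0 < n)%N ->
  realizable N p -> realizable (N + e) (p * (n%:R *: 'X + 1) ^+ e).
Proof.
move=> n_gt0 hp; elim: e => [|e IH]; first by rewrite addn0 mulr1.
by rewrite addnS -addn1 exprSr mulrA; apply/realizableM/realizable_segment.
Qed.
End Realization.

(** * Summing the column heights of the dilated Reeve polytope *)

Lemma sum_ltn a n : (a <= n -> \sum_(y < n) (y < a) = a)%N.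
Proof.
move=> /subnKC <-; rewrite big_split_ord /= -[RHS]addn0; congr addn.
  rewrite (eq_bigr (fun=> 1%N)) ?sum1_card ?card_ord // => i _.
  by rewrite ltn_ord.
by rewrite big1 // => i _; rewrite ltnNge leq_addr.
Qed.

(** Here [a] is x and [b] is t - x, and truncated subtraction encodes max(0, x + y - t). When [b]
    grows by one, the new term at y = 0 vanishes. The shift of y by one leaves the subtracted part
    unchanged and raises [minn a y] by one exactly for y < a, so the sum grows by [a]. *)
Lemma sum_reeve_slice a b :
  (\sum_(y < (a + b).+1) (minn a y - (a + y - (a + b))) = a * b)%N.
Proof.
elim: b => [|b IH].
  by rewrite muln0 big1 // => y _; have := ltn_ord y; lia.
rewrite addnS big_ord_recl minn0 sub0n add0n mulnS -IH.
transitivity (\sum_(y < (a + b).+1)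
    ((y < a) + (minn a y - (a + y - (a + b)))))%N; last first.
  by rewrite big_split /= sum_ltn ?leqW ?leq_addr.
by apply: eq_bigr => y _; rewrite lift0; have := ltn_ord y; case: ltnP; lia.
Qed.

Section Reeve.
Context {R : realType}.

Lemma sum_parabola (T : R) n :
  \sum_(x < n) x%:R * (T - x%:R) =
  T * (n%:R * (n%:R - 1)) / 2 - n%:R * (n%:R - 1) * (2 * n%:R - 1) / 6.
Proof.
elim: n => [|n IH]; first by rewrite big_ord0; field.
by rewrite big_ord_recr /= IH -natr1; field.
Qed.

Lemma sum_natr n : \sum_(x < n) x%:R = n%:R * (n%:R - 1) / 2 :> R.
Proof.
elim: n => [|n IH]; first by rewrite big_ord0; field.
by rewrite big_ord_recr /= IH -natr1; field.
Qed.

(** Length of the vertical segment above (x, y) in the t-th dilation; its endpoints are integral,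
    hence one more lattice point than its length. *)
Definition reeve_height m s t (xy : 'I_t.+1 * 'I_t.+1) : nat :=
  (m * (minn xy.1 xy.2 - (xy.1 + xy.2 - t)) + s * xy.1)%N.

Lemma sum_reeve_height m s t :
  (\sum_(xy : 'I_t.+1 * 'I_t.+1) (reeve_height m s xy).+1 : nat)%:R =
  (t%:R + 1) ^+ 2 + m%:R / 6 * (t%:R ^+ 3 - t%:R) +
    s%:R / 2 * t%:R * (t%:R + 1) ^+ 2 :> R.
Proof.
rewrite -(pair_bigA _ (fun x y => (reeve_height m s (x, y)).+1)) /=.
have slice (x : 'I_t.+1) : (\sum_(y < t.+1) (reeve_height m s (x, y)).+1 =
    m * (x * (t - x)) + t.+1 * (s * x).+1)%N.
  under eq_bigr do rewrite /reeve_height -addnS.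
  rewrite big_split /= sum_nat_const card_ord -big_distrr /=.
  have /subnKC xt : (x <= t)%N by rewrite -ltnS.
  by rewrite -(sum_reeve_slice x (t - x)) xt.
rewrite natr_sum (eq_bigr (fun x : 'I_t.+1 =>
  m%:R * (x%:R * (t%:R - x%:R)) + (t.+1%:R * s%:R * x%:R + t.+1%:R))); last first.
  move=> x _; rewrite slice natrD (natrM _ m) (natrM _ x) (natrM _ t.+1) natrB.
    by rewrite -(natr1 (s * x)) (natrM _ s); ring.
  by rewrite -ltnS.
rewrite !big_split /= -!big_distrr /= sum_parabola sum_natr sumr_const card_ord.
by rewrite -(mulr_natr t.+1%:R) -(natr1 t); field.
Qed.

(** * The thickened Reeve tetrahedron as a convex hull *)

Definition pt3 (x y z : R) : 'rV[R]_3 := \row_i [:: x; y; z]`_i.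

Lemma pt3E (v : 'rV[R]_3) : v = pt3 (v 0 0) (v 0 1) (v 0 2%:R).
Proof.
apply/rowP => -[[|[|[|//]]] lti]; rewrite mxE /=; congr (v _ _); exact: val_inj.
Qed.

Lemma pt3D x y z x' y' z' : pt3 x y z + pt3 x' y' z' = pt3 (x + x') (y + y') (z + z').
Proof. by rewrite [LHS]pt3E !mxE. Qed.

Lemma pt3Z a x y z : a *: pt3 x y z = pt3 (a * x) (a * y) (a * z).
Proof. by rewrite [LHS]pt3E !mxE. Qed.

Lemma pt3_inj x y z x' y' z' :
  pt3 x y z = pt3 x' y' z' -> [/\ x = x', y = y' & z = z'].
Proof.
by move=> /rowP e; have := (e 0, e 1, e 2%:R); rewrite !mxE /= => -[[]].
Qed.

Lemma pt3_int x y z : x \is a Num.int -> y \is a Num.int -> z \is a Num.int ->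
  pt3 x y z \is a mxOver Num.int.
Proof.
by move=> xi yi zi; apply/mxOverP => i [[|[|[|//]]] lti]; rewrite mxE.
Qed.

(* For s = 0 and T = 1 this is the Reeve tetrahedron of height m. *)
Definition reeve (m s T : R) : set 'rV[R]_3 := [set v |
  [/\ 0 <= v 0 0 <= T, 0 <= v 0 1 <= T,
      0 <= v 0 2%:R /\ m * (v 0 0 + v 0 1 - T) <= v 0 2%:R &
      v 0 2%:R <= m * v 0 0 + s * v 0 0 /\ v 0 2%:R <= m * v 0 1 + s * v 0 0]].

Lemma reeveZ m s T c v : 0 <= c -> reeve m s T v -> reeve m s (c * T) (c *: v).
Proof.
move=> c_ge0 [/andP[? ?] /andP[? ?] [? ?] [? ?]].
by split; rewrite !mxE; try (split||apply/andP; split); nra.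
Qed.

Lemma dilate_reeve m s t : (0 < t)%N -> dilate t (reeve m s 1) = reeve m s t%:R.
Proof.
move=> t_gt0; have t_neq0 : t%:R != 0 :> R by rewrite pnatr_eq0 -lt0n.
apply/seteqP; split=> [_ [x xP <-]|v vP].
  by rewrite -[X in reeve _ _ X]mulr1; apply: reeveZ.
exists (t%:R^-1 *: v); last by rewrite scalerA divff ?scale1r.
by have := @reeveZ m s t%:R t%:R^-1 v; rewrite mulVf //; apply; rewrite ?invr_ge0.
Qed.

(** The floor, folded along x + y = 1, passes through the first four points. The roof, folded along
    x = y, passes through the first, the third and the last two. *)
Definition reeve_vertices (m s : R) : seq 'rV[R]_3 :=
  [:: pt3 0 0 0; pt3 1 0 0; pt3 0 1 0; pt3 1 1 m; pt3 1 0 s; pt3 1 1 (m + s)].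

Lemma comb_closed3 N (C : set 'rV[R]_N) x y z (p q r : R) :
  comb_closed unit_interval C -> C x -> C y -> C z ->
  0 <= p -> 0 <= q -> 0 <= r -> p + q + r = 1 -> C (p *: x + q *: y + r *: z).
Proof.
move=> cC Cx Cy Cz p0 q0 r0 pqr1; have [pq0|pq0] := eqVneq (p + q) 0.
  have -> : p = 0 by lra.
  have -> : q = 0 by lra.
  have -> : r = 1 by lra.
  by rewrite !scale0r !add0r scale1r.
have pq_gt0 : 0 < p + q by rewrite lt_neqAle eq_sym pq0 addr_ge0.
have -> : p *: x + q *: y + r *: z =
    (p + q) *: (p / (p + q) *: x + (1 - p / (p + q)) *: y) + (1 - (p + q)) *: z.
  rewrite scalerDr !scalerA; congr (_ *: _ + _ *: _ + _ *: _); try by field.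
  lra.
apply: (cC) => //; first by apply/andP; split; lra.
apply: cC => //; apply/andP; split; first by rewrite divr_ge0 // ltW.
by rewrite ler_pdivrMr // mul1r lerDl.
Qed.

(** For the inclusion from right to left, a point is placed on the vertical segment between the
    floor and the roof. Each of these consists of two triangles spanned by the listed points, and
    the weights used are barycentric coordinates in them. *)
Lemma convex_hull_reeve (m s : R) : 0 <= m -> 0 <= s ->
  convex_hull [set` reeve_vertices m s] = reeve m s 1.
Proof.
move=> m_ge0 s_ge0; rewrite convex_hullE; apply/seteqP; split.
  apply: smallest_sub => [x y a /andP[a0 a1]|x /=].
    move=> [/andP[? ?] /andP[? ?] [? ?] [? ?]] [/andP[? ?] /andP[? ?] [? ?] [? ?]].
    by split; rewrite !mxE; try (split||apply/andP; split); nra.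
  rewrite !inE; do !case/orP; move=> /eqP ->; split; rewrite !mxE /=;
    by try (split||apply/andP; split); lra.
move=> v; rewrite [v]pt3E /reeve /= !mxE /=.
move: (v 0 0) (v 0 1) (v 0 2%:R) => x y z.
move=> [/andP[x0 x1] /andP[y0 y1] [z0 zl] [zx zy]] C [cC AC].
have Cv u : u \in reeve_vertices m s -> C u by move=> ?; exact: AC.
(* The floor point below (x, y, z), in the triangle on the relevant side of x + y = 1. *)
have [l lz Cl] : exists2 l, l <= z & C (pt3 x y l).
  have [xy|xy] := leP (x + y) 1.
    exists 0 => //.
    have := @comb_closed3 _ C (pt3 0 0 0) (pt3 1 0 0) (pt3 0 1 0) (1 - x - y) x y cC.
    rewrite !pt3Z !pt3D !(mulr0, mulr1, addr0, add0r).
    by apply; try (by apply: Cv; rewrite !inE eqxx ?orbT); lra.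
  exists (m * (x + y - 1)) => //.
  have := @comb_closed3 _ C (pt3 1 0 0) (pt3 0 1 0) (pt3 1 1 m)
    (1 - y) (1 - x) (x + y - 1) cC.
  rewrite !pt3Z !pt3D.
  have -> : (1 - y) * 1 + (1 - x) * 0 + (x + y - 1) * 1 = x by ring.
  have -> : (1 - y) * 0 + (1 - x) * 1 + (x + y - 1) * 1 = y by ring.
  have -> : (1 - y) * 0 + (1 - x) * 0 + (x + y - 1) * m = m * (x + y - 1) by ring.
  by apply; try (by apply: Cv; rewrite !inE eqxx ?orbT); lra.
(* The roof point above it, in the triangle on the relevant side of x = y. *)
have [u zu Cu] : exists2 u, z <= u & C (pt3 x y u).
  have [xy|xy] := leP x y.
    exists (m * x + s * x) => //.
    have := @comb_closed3 _ C (pt3 0 0 0) (pt3 0 1 0) (pt3 1 1 (m + s))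
      (1 - y) (y - x) x cC.
    rewrite !pt3Z !pt3D.
    have -> : (1 - y) * 0 + (y - x) * 0 + x * 1 = x by ring.
    have -> : (1 - y) * 0 + (y - x) * 1 + x * 1 = y by ring.
    have -> : (1 - y) * 0 + (y - x) * 0 + x * (m + s) = m * x + s * x by ring.
    by apply; try (by apply: Cv; rewrite !inE eqxx ?orbT); lra.
  exists (m * y + s * x) => //.
  have := @comb_closed3 _ C (pt3 0 0 0) (pt3 1 0 s) (pt3 1 1 (m + s))
    (1 - x) (x - y) y cC.
  rewrite !pt3Z !pt3D.
  have -> : (1 - x) * 0 + (x - y) * 1 + y * 1 = x by ring.
  have -> : (1 - x) * 0 + (x - y) * 0 + y * 1 = y by ring.
  have -> : (1 - x) * 0 + (x - y) * s + y * (m + s) = m * y + s * x by ring.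
  by apply; try (by apply: Cv; rewrite !inE eqxx ?orbT); lra.
have [lu|lu] := eqVneq l u; first by have -> : z = l by lra.
have lu_gt0 : 0 < u - l by rewrite subr_gt0 lt_neqAle lu; lra.
have := cC _ _ ((u - z) / (u - l)) _ Cl Cu; rewrite !pt3Z !pt3D.
rewrite -!mulrDl subrKC !mul1r.
have -> : (u - z) / (u - l) * l + (1 - (u - z) / (u - l)) * u = z.
  by field; rewrite gt_eqF.
apply; apply/andP; split; first by rewrite divr_ge0 ?(ltW lu_gt0) ?subr_ge0.
by rewrite ler_pdivrMr //; lra.
Qed.
End Reeve.

(** * Ehrhart polynomial of the thickened Reeve tetrahedron *)

Section ReevePolynomial.
Context {R : realType}.

(** A lattice point is encoded by its projection (x, y) and its offset [k] above the floor of that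
    column. *)
Lemma lattice_points_reeve m s t :
  (lattice_points (@reeve R m%:R s%:R t%:R) #=
     `I_(\sum_(xy : 'I_t.+1 * 'I_t.+1) (reeve_height m s xy).+1))%card.
Proof.
pose T := {xy : 'I_t.+1 * 'I_t.+1 & 'I_(reeve_height m s xy).+1}.
pose f (p : T) : 'rV[R]_3 := let: existT (x, y) k := p in
  pt3 x%:R y%:R (m * (x + y - t) + k)%:R.
have -> : (\sum_(xy : 'I_t.+1 * 'I_t.+1) (reeve_height m s xy).+1)%N = #|{: T}|.
  rewrite card_tagged sumnE big_map big_enum /=.
  by apply: eq_bigr => xy _; rewrite card_ord.
apply: (@card_eq_inj_image _ _ f).
  move=> [[x y] k] [[x' y'] k'] /pt3_inj[/eqP + /eqP + /eqP].
  rewrite !eqr_nat => /eqP/val_inj ex /eqP/val_inj ey.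
  subst x' y'; rewrite eqn_add2l => /eqP/val_inj ek.
  by rewrite ek.
move=> v; split=> [[[/andP[x0 xt] /andP[y0 yt] [z0 zl] [zx zy]] /mxOverP vint]|].
  have [x xE] := natr_of_int_ge0 (vint 0 0) x0.
  have [y yE] := natr_of_int_ge0 (vint 0 1) y0.
  have [z zE] := natr_of_int_ge0 (vint 0 2%:R) z0.
  rewrite xE yE zE in xt yt zl zx zy.
  move: xt yt zx zy; rewrite -!natrM -!natrD !ler_nat => xt yt zx zy.
  (* Truncation replaces a negative bound by 0, which is harmless because [z] is nonnegative. *)
  have {}zl : (m * (x + y - t) <= z)%N.
    have [txy|/ltnW/eqP ->] := leqP t (x + y); last by rewrite muln0.
    by rewrite -(ler_nat R) natrM natrB // natrD.
  have xt' : (x < t.+1)%N by [].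
  have yt' : (y < t.+1)%N by [].
  have kP : (z - m * (x + y - t) < (@reeve_height m s t (Ordinal xt', Ordinal yt')).+1)%N.
    rewrite ltnS /reeve_height /= (mulnBr _ (minn _ _)).
    have : (z <= m * minn x y + s * x)%N by case: (leqP x y).
    have : (m * (x + y - t) <= m * minn x y)%N by rewrite leq_mul2l; lia.
    lia.
  exists (existT _ (Ordinal xt', Ordinal yt') (Ordinal kP)).
  by rewrite /f /= [v]pt3E xE yE zE subnKC.
case=> -[[x y] [k kh]] <- /=; split; last by apply: pt3_int; apply: rpred_nat.
have := (ltn_ord x, ltn_ord y); rewrite !ltnS => -[xt yt].
move: kh; rewrite ltnS /reeve_height /= (mulnBr _ (minn _ _)) => kh.
have hm : (m * (x + y - t) <= m * minn x y)%N by rewrite leq_mul2l; lia.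
have hx : (m * minn x y <= m * x)%N by rewrite leq_mul2l geq_minl orbT.
have hy : (m * minn x y <= m * y)%N by rewrite leq_mul2l geq_minr orbT.
rewrite /reeve /= !mxE /= -!natrM -!natrD !ler_nat !ler0n xt yt; split=> //.
  split=> //; have [txy|txy] := leqP t (x + y).
    by rewrite -natrB // -natrM ler_nat leq_addr.
  apply: (@le_trans _ _ 0); last exact: ler0n.
  by rewrite mulr_ge0_le0 ?ler0n // subr_le0 ler_nat ltnW.
by split; lia.
Qed.

(** An affine set through 0 is a linear subspace, and for nonzero [s] the points (1,0,0), (0,1,0),
    (1,0,s) form a basis. *)
Lemma affine_hull_reeve (m s : R) : s != 0 ->
  affine_hull [set` reeve_vertices m s] = setT.
Proof.
move=> s_neq0; rewrite affine_hullE; apply/seteqP; split=> v // _ C [cC AC].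
have Cv u : u \in reeve_vertices m s -> C u by move=> ?; exact: AC.
have C0 : C 0.
  have -> : 0 = pt3 0 0 0 :> 'rV[R]_3 by rewrite [LHS]pt3E !mxE.
  by apply: Cv; rewrite !inE eqxx.
have CZ a x : C x -> C (a *: x).
  by move=> Cx; have := cC x 0 a I Cx C0; rewrite scaler0 addr0.
(* The sum is twice the midpoint. *)
have CD x y : C x -> C y -> C (x + y).
  move=> Cx Cy; have := CZ 2 _ (cC x y 2^-1 I Cx Cy).
  have -> : 1 - 2^-1 = 2^-1 :> R by field.
  by rewrite -scalerDr scalerA divff ?scale1r ?pnatr_eq0.
have -> : v = (v 0 0 - v 0 2%:R / s) *: pt3 1 0 0 + v 0 1 *: pt3 0 1 0 +
              (v 0 2%:R / s) *: pt3 1 0 s.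
  by rewrite [LHS]pt3E !pt3Z !pt3D; congr pt3; field.
by apply: (CD); [apply: CD|]; apply: CZ; apply: Cv; rewrite !inE eqxx ?orbT.
Qed.

(** In the coefficient of t, the part 3cE of [m] cancels the contribution of [s] and the part 6E
    leaves -E. Positivity of [c] and [E] makes [s] nonzero, hence the polytope full-dimensional. *)
Lemma realizable_reeve c E : (0 < c)%N -> (0 < E)%N ->
  @realizable R 3 (('X + 1) ^+ 2 +
    E%:R *: (c.+1%:R *: 'X^3 + c%:R *: 'X^2 - 'X)).
Proof.
move=> c_gt0 E_gt0; pose m := (6 * E + 3 * (c * E))%N; pose s := (c * E)%N.
exists [set` reeve_vertices m%:R s%:R]; split.
- exact: finite_seq.
- move=> v /=; rewrite !inE; do !case/orP; move=> /eqP ->;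
    by apply: pt3_int; rewrite ?rpredD ?rpred_nat ?rpred0 ?rpred1.
- by apply: affine_hull_reeve; rewrite pnatr_eq0 -lt0n muln_gt0 c_gt0.
move=> t t_gt0; rewrite convex_hull_reeve ?ler0n // dilate_reeve //.
exists (\sum_(xy : 'I_t.+1 * 'I_t.+1) (reeve_height m s xy).+1)%N.
  exact: lattice_points_reeve.
by rewrite sum_reeve_height !hornerE /m /s natrD !natrM -(natr1 c) /=; field.
Qed.
End ReevePolynomial.

(** * Signs of coefficients under multiplication by segments *)

Section SignPatterns.
Context {R : realType}.
Implicit Types (a b p : {poly R}) (n k : nat).

Lemma coef0_mul_segment p n : (p * (n%:R *: 'X + 1))`_0 = p`_0.
Proof. by rewrite mulrDr mulr1 -scalerAr coefD coefZ coefMX /= mulr0 add0r. Qed.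

Lemma coefS_mul_segment p n k :
  (p * (n%:R *: 'X + 1))`_k.+1 = n%:R * p`_k + p`_k.+1.
Proof. by rewrite mulrDr mulr1 -scalerAr coefD coefZ coefMX. Qed.

(** The polynomial is that of the unit cube, written as a power of [realizable_segment] at n = 1.
    Nonnegativity for every [k] carries the induction at the top coefficient. *)
Lemma coef_segment_exp_gt0 e :
  let p : {poly R} := (1%:R *: 'X + 1) ^+ e in
  forall k, 0 <= p`_k /\ ((k <= e)%N -> 0 < p`_k).
Proof.
elim: e => [|e IH] p k; first by rewrite /p expr0 coef1; case: k.
rewrite /p exprSr; case: k => [|k].
  by rewrite coef0_mul_segment; have [? /(_ isT) ?] := IH 0%N.
rewrite coefS_mul_segment mul1r ltnS; have [? pk] := IH k; have [? _] := IH k.+1.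
by split=> [|/pk ?]; rewrite ?addr_ge0 ?ltr_wpDr.
Qed.

(* The exact sign of the coefficients below 'X^3 has to be tracked because
   every factor 'X + 1 lowers the coefficient of 'X^2 by one. *)
Lemma coef_reeve_mul_exp c r : (r <= c)%N ->
  let b : {poly R} :=
    (c.+1%:R *: 'X^3 + c%:R *: 'X^2 - 'X) * (1%:R *: 'X + 1) ^+ r in
  [/\ b`_0 = 0, b`_1 = -1, b`_2 = (c - r)%:R &
      forall k, 0 <= b`_k.+3 /\ ((k <= r)%N -> 0 < b`_k.+3)].
Proof.
elim: r => [|r IH] ltrc b.
  rewrite /b expr0 mulr1; split; rewrite ?subn0.
  1-3: by rewrite !(coefB, coefD, coefZ, coefXn, coefX) /=; ring.
  move=> k; rewrite !(coefB, coefD, coefZ, coefXn, coefX) /=.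
  by case: k => [|k] /=; rewrite !mulr0 !(mulr1, addr0, subr0, oppr0).
rewrite /b (exprSr _ r) mulrA; have [b0 b1 b2 b3] := IH (ltnW ltrc).
split; rewrite ?coef0_mul_segment ?coefS_mul_segment //.
- by rewrite b0 b1 mulr0 add0r.
- by rewrite b1 b2 -(subnSK ltrc) -natr1; ring.
move=> k; rewrite coefS_mul_segment mul1r; have [b3k b3k_gt] := b3 k.
case: k => [|k] in b3k b3k_gt *.
  by rewrite b2; have b3_gt0 := b3k_gt isT; split=> [|_]; rewrite ?addr_ge0 ?ltr_wpDl.
have [b2k b2k_gt] := b3 k.
by split=> [|/b2k_gt ?]; rewrite ?addr_ge0 ?ltr_wpDr.
Qed.

(** The zero constant term keeps the coefficient of t unchanged under multiplication by n t + 1.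
    Nonnegativity above [N] covers the index N + 1, needed when the degree bound rises. *)
Definition sign_pattern j N b : Prop :=
  [/\ b`_0 = 0, forall k, (0 < k <= j)%N -> b`_k < 0,
      forall k, (j < k)%N -> 0 <= b`_k & forall k, (j < k <= N)%N -> 0 < b`_k].

Definition realizable_family N a b : Prop :=
  forall E, (0 < E)%N -> realizable N (a + E%:R *: b).

Lemma realizable_family_mul N a b n : (0 < n)%N -> realizable_family N a b ->
  realizable_family N.+1 (a * (n%:R *: 'X + 1)) (b * (n%:R *: 'X + 1)).
Proof.
move=> n_gt0 hab E E_gt0; rewrite scalerAl -mulrDl -addn1.
exact/realizableM/realizable_segment/n_gt0/hab.
Qed.

(** The new coefficient at k is n b_(k-1) + b_k. The two terms have conflicting signs at most at k =
    j + 1, where b_j < 0 wins for large n. *)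
Lemma sign_pattern_step j N b : (0 < j)%N -> sign_pattern j N b ->
  exists2 n, (0 < n)%N & sign_pattern j.+1 N.+1 (b * (n%:R *: 'X + 1)).
Proof.
move=> j_gt0 [b0 b_lt0 b_ge0 b_gt0].
have bj : b`_j < 0 by apply: b_lt0; rewrite j_gt0 leqnn.
(* Any n above b_(j+1) / (-b_j) works; the successor makes it positive. *)
pose n := (Num.bound `|b`_j.+1 / - b`_j|).+1; exists n => //.
have n_large : n%:R * b`_j + b`_j.+1 < 0.
  have : `|b`_j.+1 / - b`_j| < n%:R.
    by apply: lt_trans (archi_boundP (normr_ge0 _)) _; rewrite ltr_nat.
  move=> /(le_lt_trans (ler_norm _)); rewrite ltr_pdivrMr ?oppr_gt0 //; lra.
have n_gt0 : 0 < n%:R :> R by rewrite ltr0n.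
split; first by rewrite coef0_mul_segment.
- case=> // k; rewrite coefS_mul_segment !ltnS /= leq_eqVlt => /predU1P[-> //|ltkj].
  have bk1 : b`_k.+1 < 0 by apply: b_lt0.
  have bk : b`_k <= 0.
    by case: k {bk1} ltkj => [|k] ltkj; [rewrite b0 | rewrite ltW ?b_lt0 ?(ltnW ltkj)].
  by have := mulr_ge0_le0 (ltW n_gt0) bk; lra.
- case=> // k; rewrite ltnS coefS_mul_segment => ltjk.
  by rewrite addr_ge0 ?mulr_ge0 ?b_ge0 ?(ltW n_gt0) // leqW.
- case=> // k; rewrite !ltnS coefS_mul_segment => /andP[ltjk lekN].
  by rewrite ltr_wpDr ?b_ge0 ?leqW // mulr_gt0 // b_gt0 // ltjk.
Qed.

Lemma realizable_sign_pattern beta e :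
  exists a b, realizable_family (beta + e).+3 a b /\
              sign_pattern e.+1 (beta + e).+3 b.
Proof.
elim: e => [|e [a [b [hab sab]]]].
  pose q : {poly R} := (1%:R *: 'X + 1) ^+ beta.
  exists (('X + 1) ^+ 2 * q), ((beta.+2%:R *: 'X^3 + beta.+1%:R *: 'X^2 - 'X) * q).
  split=> [E E_gt0|].
    rewrite scalerAl -mulrDl addn0 -[beta.+3]add3n.
    by apply: realizableXn => //; apply: realizable_reeve.
  (* The coefficient of t^2 is c - beta after beta unit segments, so c = beta + 1 is the least
     choice keeping it positive. *)
  have [b0 b1 b2 b3] := @coef_reeve_mul_exp beta.+1 beta (leqnSn _).
  rewrite -/q subSnn in b0 b1 b2 b3.
  split=> //.
  - by move=> [|[|k]] // _; rewrite b1 ltrN10.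
  - by move=> [|[|[|k]]] // _; [rewrite b2 | case: (b3 k)].
  - move=> [|[|[|k]]] //; first by rewrite b2.
    by rewrite addn0 !ltnS /= => /(b3 k).2.
have [n n_gt0 sn] := sign_pattern_step (ltn0Sn e) sab.
exists (a * (n%:R *: 'X + 1)), (b * (n%:R *: 'X + 1)); rewrite addnS; split=> //.
exact: realizable_family_mul.
Qed.

Lemma dominant_coef_sign a b N : exists2 E, (0 < E)%N &
  forall k, (k < N)%N -> (b`_k < 0 -> (a + E%:R *: b)`_k < 0) /\
                         (0 < b`_k -> 0 < (a + E%:R *: b)`_k).
Proof.
(* A sum of natural numbers dominates each of them, so one [E] serves all k. Where b_k = 0 the
   quotient is 0 by convention, and nothing is claimed there. *)
pose E := (\sum_(k < N) Num.bound (`|a`_k| / `|b`_k|)%R).+1; exists E => // k ltkN.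
have E_large : b`_k != 0 -> `|a`_k| < E%:R * `|b`_k|.
  rewrite -normr_gt0 => bk_gt0; rewrite -ltr_pdivrMr //.
  apply: lt_le_trans (archi_boundP _) _; first by rewrite divr_ge0.
  by rewrite ler_nat /E (bigD1 (Ordinal ltkN)) //= leqW // leq_addr.
rewrite coefD coefZ; split=> bk.
  have := E_large (ltr0_neq0 bk); rewrite (ltr0_norm bk) => ?.
  have := ler_norm a`_k; nra.
have := E_large (lt0r_neq0 bk); rewrite (gtr0_norm bk) => ?.
have := lerNnormlW (lexx `|a`_k|); nra.
Qed.
End SignPatterns.

Theorem theorem4p5 (R : realType) (beta d : nat)
    (beta_gt0 : (0 < beta)%N) (d_gt0 : (0 < d)%N) (le_d : (beta + 2 <= d)%N) :
  exists (N : nat) (P : set 'rV[R]_N) (i_P : {poly R}),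
    [/\ integral_polytope P, has_dim P d & ehrhart_polynomial P i_P] /\
    (forall k : nat, (d - beta - 1 <= k <= d - 2)%N -> 0 < i_P`_k) /\
    (forall k : nat, (1 <= k <= d - beta - 2)%N -> i_P`_k < 0).
Proof.
suff [p [realp [p_gt0 p_lt0]]] : exists p : {poly R}, realizable d p /\
    (forall k : nat, (d - beta - 1 <= k <= d - 2)%N -> 0 < p`_k) /\
    (forall k : nat, (1 <= k <= d - beta - 2)%N -> p`_k < 0).
  by have [P hP] := realizable_polytope realp; exists d, P, p.
(* For d = beta + 2 no coefficient has to be negative, and the unit cube suffices. *)
have [d_eq|d_neq] := eqVneq d (beta + 2)%N.
  exists ((1%:R *: 'X + 1) ^+ d); split; last by split=> k; [|lia];
    by move=> ?; apply: (coef_segment_exp_gt0 d k).2; lia.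
  case: d d_gt0 {le_d d_eq} => // d _; rewrite exprS -[d.+1]add1n.
  by apply: realizableXn => //; apply: realizable_segment.
(* With this [e] the last negative index e + 1 is d - beta - 2. *)
have [e d_eq] : exists e, d = (beta + e).+3 by exists (d - beta - 3)%N; lia.
have [a [b [hab [_ b_lt0 _ b_gt0]]]] := @realizable_sign_pattern R beta e.
have [E E_gt0 signE] := dominant_coef_sign a b d.
exists (a + E%:R *: b); split; first by rewrite d_eq; apply: hab.
split=> k hk.
  by apply: (signE k _).2; [lia | apply: b_gt0; lia].
by apply: (signE k _).1; [lia | apply: b_lt0; lia].
Qed.
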